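(* Let $n,r\ge1$ be integers. The set $\mathcal{B}=\{[f_1,f_1+f_2]\,[f_1+f_2,f_2] \;:\; [f_1,f_2]\in\mathcal{F}\times\mathcal{F}/\mathrm{GL}(V)\}$, the products being taken in $S_q(n,r)$, is a $\mathbb{Z}[q]$-basis of $S_q(n,r)$.
   Context: Let $k$ be a field which is finite or algebraically closed, $V$ an $r$-dimensional $k$-space and $\mathcal{F}$ the set of $n$-step flags $f:\{0\}=V_0\subseteq V_1\subseteq\cdots\subseteq V_n=V$. $\mathrm{GL}(V)$ acts diagonally on $\mathcal{F}\times\mathcal{F}$; $[f,f']$ is the orbit of $(f,f')$. The orbits are in bijection with $n\times n$ matrices of non-negative integers with entries summing to $r$ via $A(f,f')_{ij}=\dim(V_{i-1}+V_i\cap V'_j)-\dim(V_{i-1}+V_i\cap V'_{j-1})$, for $f=(V_i)$, $f'=(V'_i)$; $e_A$ is the orbit with matrix $A$. For flags $f_1,f_2$, $f_1+f_2$ is the flag whose $i$-th space is the sum of the $i$-th spaces. There are polynomials $g_{A,A',A''}\in\mathbb{Z}[q]$ such that over every finite field and any $(f_1,f_2)\in e_{A''}$, the value of $g_{A,A',A''}$ at the cardinality of the field is the number of $f\in\mathcal{F}$ with $(f_1,f)\in e_A$ and $(f,f_2)\in e_{A'}$. The $q$-Schur algebra $S_q(n,r)$ is the free $\mathbb{Z}[q]$-module ($q$ an indeterminate) with basis the orbits $e_A$ and multiplication $e_Ae_{A'}=\sum_{A''}g_{A,A',A''}e_{A''}$. The element $[f_1,f_1+f_2][f_1+f_2,f_2]$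 depends only on the orbit $[f_1,f_2]$. *)

(* Defs.v *)
From HB Require Import structures.
From mathcomp Require Import all_boot all_order all_algebra.
From mathcomp Require Import boolp classical_sets functions cardinality.
From mathcomp Require Import zify.

Set Implicit Arguments.
Unset Strict Implicit.
Unset Printing Implicit Defensive.

Import GRing.Theory.

Local Open Scope classical_set_scope.
Local Open Scope ring_scope.

Section ModuleBasis.
Variables (R : pzRingType) (M : lmodType R).

Definition lin_indep (B : set M) : Prop :=
  forall (s : seq M) (c : M -> R), uniq s -> (forall v, v \in s -> B v) ->
    \sum_(v <- s) c v *: v = 0 -> forall v, v \in s -> c v = 0.

Definition spanning (B : set M) : Prop :=
  forall x : M, exists (s : seq M) (c : M -> R),
    (forall v, v \in s -> B v) /\ x = \sum_(v <- s) c v *: v.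

Definition is_basis (B : set M) : Prop := lin_indep B /\ spanning B.

End ModuleBasis.

(* For i : 'I_n, standing for the step i + 1 of 1, ..., n, the indices of the
   spaces below and above that step. *)
Definition lo n (i : 'I_n) : 'I_n.+1 := widen_ord (leqnSn n) i.
Definition hi n (i : 'I_n) : 'I_n.+1 := lift ord0 i.

Section Flags.
Variables (n : nat) (k : fieldType) (V : vectType k).

Definition is_flag (f : {ffun 'I_n.+1 -> {vspace V}}) : bool :=
  [&& f ord0 == 0%VS, f ord_max == fullv
    & [forall i : 'I_n, (f (lo i) <= f (hi i))%VS]].

Record flag := Flag { flag_fun :> {ffun 'I_n.+1 -> {vspace V}};
                      flag_axiom : is_flag flag_fun }.

HB.instance Definition _ := [isSub for flag_fun].
HB.instance Definition _ := [Choice of flag by <:].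

Lemma flag_add_subproof (f f' : flag) : is_flag [ffun i => f i + f' i]%VS.
Proof.
case/and3P: (flag_axiom f) => /eqP f0 /eqP fn /forallP fS.
case/and3P: (flag_axiom f') => /eqP f0' /eqP fn' /forallP fS'.
apply/and3P; split; rewrite ?ffunE.
- by rewrite f0 f0' addv0.
- by rewrite fn fn' addvv.
- by apply/forallP=> i; rewrite !ffunE addvS.
Qed.

Definition flag_add (f f' : flag) : flag := Flag (flag_add_subproof f f').

Lemma flag_act_subproof (u : 'End(V)) (u0 : lker u == 0%VS) (f : flag) :
  is_flag [ffun i => u @: f i]%VS.
Proof.
case/and3P: (flag_axiom f) => /eqP f0 /eqP fn /forallP fS.
apply/and3P; split; rewrite ?ffunE.
- by rewrite f0 limg0.
- by rewrite fn lker0_limgf.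
- by apply/forallP=> i; rewrite !ffunE limgS.
Qed.

(* GL(V) is the set of endomorphisms of V with trivial kernel. *)
Definition flag_act (u : 'End(V)) (u0 : lker u == 0%VS) (f : flag) : flag :=
  Flag (flag_act_subproof u0 f).

Definition flag_orbit (f f' : flag) : set (flag * flag) :=
  [set p | exists (u : 'End(V)) (u0 : lker u == 0%VS),
             p = (flag_act u0 f, flag_act u0 f')].

(* The subtraction is exact, the flag f' being increasing. *)
Definition rel_pos (f f' : flag) : 'M[nat]_n :=
  \matrix_(i, j) (\dim (f (lo i) + f (hi i) :&: f' (hi j))
                  - \dim (f (lo i) + f (hi i) :&: f' (lo j)))%N.

End Flags.

(* The n x n matrices of non-negative integers with entries summing to r;
   their entries are at most r, hence the finite type. *)
Definition smx (n r : nat) : Type :=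
  {A : 'M['I_r.+1]_n | (\sum_i \sum_j A i j)%N == r}.

Section NatFlags.
Variables (n : nat) (k : fieldType) (V : vectType k).
Implicit Types f : flag n V.

Let fn f m : {vspace V} := f (inord m).

Let fn_lo f (i : 'I_n) : f (lo i) = fn f i.
Proof. by congr (f _); apply: val_inj; rewrite /= inordK // ltnS ltnW. Qed.

Let fn_hi f (i : 'I_n) : f (hi i) = fn f i.+1.
Proof. by congr (f _); apply: val_inj; rewrite /= inordK // ltnS. Qed.

Let fn0 f : fn f 0 = 0%VS.
Proof.
case/and3P: (flag_axiom f) => /eqP <- _ _.
by congr (f _); apply: val_inj; rewrite /= inordK.
Qed.

Let fnn f : fn f n = fullv.
Proof.
case/and3P: (flag_axiom f) => _ /eqP <- _.
by congr (f _); apply: val_inj; rewrite /= inordK.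
Qed.

Let fnS f i : (i < n)%N -> (fn f i <= fn f i.+1)%VS.
Proof.
move=> lt_in; case/and3P: (flag_axiom f) => _ _ /forallP/(_ (Ordinal lt_in)).
by rewrite fn_lo fn_hi.
Qed.

Let fn_mono f i j : (i <= j)%N -> (j <= n)%N -> (fn f i <= fn f j)%VS.
Proof.
elim: j => [|j IH]; first by rewrite leqn0 => /eqP->.
rewrite leq_eqVlt => /orP[/eqP->//|lt_ij] lt_jn.
exact: subv_trans (IH lt_ij (ltnW lt_jn)) (fnS f lt_jn).
Qed.

Let flagE f i : f i = fn f i.
Proof. by congr (f _); rewrite inord_val. Qed.

Let d f f' i j := (\dim (fn f i + fn f i.+1 :&: fn f' j.+1)
                   - \dim (fn f i + fn f i.+1 :&: fn f' j))%N.

Let rel_posE f f' i j : rel_pos f f' i j = d f f' i j.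
Proof. by rewrite mxE !fn_lo !fn_hi. Qed.

Lemma rel_pos_sum f f' : (\sum_i \sum_j rel_pos f f' i j)%N = \dim {:V}.
Proof.
have Hrow (i : 'I_n) :
    (\sum_j rel_pos f f' i j = \dim (fn f i.+1) - \dim (fn f i))%N.
  under eq_bigr => j _ do rewrite rel_posE.
  rewrite -(big_mkord xpredT (fun j => d f f' i j)) /d.
  rewrite telescope_sumn_in //.
    by rewrite fnn fn0 capvf capv0 addv0 (addv_idPr (fnS f (ltn_ord i))).
  move=> j /andP[_ lt_jn]; apply: dimvS; apply: addvS => //.
  by apply: capvS => //; apply: fnS.
under eq_bigr => i _ do rewrite Hrow.
rewrite -(big_mkord xpredT (fun i => \dim (fn f i.+1) - \dim (fn f i))%N).
rewrite telescope_sumn_in //; first by rewrite fnn fn0 dimv0 subn0.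
by move=> i /andP[_ lt_in]; apply: dimvS; apply: fnS.
Qed.

Let C f f' (p : 'I_n * 'I_n) : {vspace V} :=
  ((fn f p.1.+1 :&: fn f' p.2.+1) :\:
   (fn f p.1 :&: fn f' p.2.+1 + fn f p.1.+1 :&: fn f' p.2))%VS.

Let dimC f f' p : \dim (C f f' p) = rel_pos f f' p.1 p.2.
Proof.
rewrite rel_posE /d /C; case: p => i j /=.
have Ui := fnS f (ltn_ord i); have Wj := fnS f' (ltn_ord j).
set U := fn f i in Ui *; set U1 := fn f i.+1 in Ui *.
set W := fn f' j in Wj *; set W1 := fn f' j.+1 in Wj *.
have sub : ((U :&: W1 + U1 :&: W) <= U1 :&: W1)%VS.
  by rewrite subv_add capvS //= capvS.
have := dimv_cap_compl (U1 :&: W1) (U :&: W1 + U1 :&: W).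
rewrite (capv_idPr sub).
have := dimv_sum_cap (U :&: W1) (U1 :&: W).
have -> : ((U :&: W1) :&: (U1 :&: W) = U :&: W)%VS.
  rewrite -capvA (capvA W1) (capvC W1) -(capvA U1) capvA.
  by rewrite (capv_idPl Ui) (capv_idPr Wj).
have := dimv_sum_cap U (U1 :&: W1); rewrite capvA (capv_idPl Ui).
have := dimv_sum_cap U (U1 :&: W); rewrite capvA (capv_idPl Ui).
by lia.
Qed.

Let capE f f' i j : (i <= n)%N -> (j <= n)%N ->
  (fn f i :&: fn f' j =
   \sum_(p : 'I_n * 'I_n | (p.1 < i)%N && (p.2 < j)%N) C f f' p)%VS.
Proof.
move=> le_in le_jn; apply/eqP; rewrite eqEsubv; apply/andP; split; last first.
  apply/subv_sumP => -[a b] /= /andP[lt_ai lt_bj].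
  apply: subv_trans (diffvSl _ _) _ => /=.
  by apply: capvS; apply: fn_mono.
elim: i le_in j le_jn => [|i IHi] lt_in j; first by rewrite fn0 cap0v sub0v.
elim: j => [|j IHj] lt_jn; first by rewrite fn0 capv0 sub0v.
set S := (X in (_ <= X)%VS).
have mono a b : (a <= i.+1)%N -> (b <= j.+1)%N ->
    ((\sum_(p : 'I_n * 'I_n | (p.1 < a)%N && (p.2 < b)%N) C f f' p) <= S)%VS.
  move=> le_a le_b; apply/subv_sumP => p /andP[p1 p2].
  by apply: (sumv_sup p) => //; rewrite (leq_trans p1) // (leq_trans p2).
have Cij : (C f f' (Ordinal lt_in, Ordinal lt_jn) <= S)%VS.
  by apply: (sumv_sup (Ordinal lt_in, Ordinal lt_jn)) => //=; rewrite !ltnSn.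
set T := (fn f i :&: fn f' j.+1 + fn f i.+1 :&: fn f' j)%VS.
have sT : (T <= S)%VS.
  rewrite subv_add (subv_trans (IHi (ltnW lt_in) _ lt_jn)) ?mono //=.
  by rewrite (subv_trans (IHj (ltnW lt_jn))) ?mono.
apply: (@subv_trans _ _ (C f f' (Ordinal lt_in, Ordinal lt_jn) + T)%VS).
  by rewrite /C /= -/T addv_diff addvSl.
by rewrite subv_add Cij.
Qed.

Let sumC f f' : (\sum_p C f f' p)%VS = fullv.
Proof.
rewrite -[RHS]capvv -{1}(fnn f) -(fnn f') capE //.
by apply: eq_bigl => p; rewrite !ltn_ord.
Qed.

Let directC f f' : directv (\sum_p C f f' p).
Proof.
rewrite directvE /= sumC -(rel_pos_sum f f') pair_bigA /=; apply/eqP.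
by apply: eq_bigr => p _; rewrite dimC.
Qed.

Let fE f f' i : f i = (\sum_(p : 'I_n * 'I_n | (p.1 < i)%N) C f f' p)%VS.
Proof.
rewrite flagE -[LHS]capvf -(fnn f') capE // -1?ltnS //.
by apply: eq_bigl => p; rewrite ltn_ord andbT.
Qed.

Let fE' f f' i : f' i = (\sum_(p : 'I_n * 'I_n | (p.2 < i)%N) C f f' p)%VS.
Proof.
rewrite flagE -[LHS]capfv -(fnn f) capE // -1?ltnS //.
by apply: eq_bigl => p; rewrite ltn_ord.
Qed.

(* Bijection between orbits and matrices: rel_pos is a complete invariant of
   the diagonal action of GL(V). *)
Lemma flag_orbitP f1 f1' f2 f2' :
  flag_orbit f1 f1' (f2, f2') <-> rel_pos f2 f2' = rel_pos f1 f1'.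
Proof.
split=> [[u [u0 [-> ->]]]|eqA].
  apply/matrixP=> i j; rewrite !mxE !ffunE.
  rewrite -!lker0_img_cap // -!limgD.
  by rewrite !limg_dim_eq // (eqP u0) capv0.
pose b f f' p : seq V := vbasis (C f f' p).
pose X f f' := \big[cat/[::]]_p b f f' p.
have Xb f f' : basis_of fullv (X f f').
  rewrite -(sumC f f'); apply: bigcat_basis => [|p _]; first exact: directC.
  exact: vbasisP.
have sz p : size (b f1 f1' p) = size (b f2 f2' p).
  by rewrite !size_tuple !dimC eqA.
have XE f f' : X f f' = flatten [seq b f f' p | p <- index_enum _].
  rewrite /X; elim: (index_enum _) => [|p s IH]; first by rewrite big_nil.
  by rewrite big_cons IH.
have sh : shape [seq b f2 f2' p | p <- index_enum _]
          = shape [seq b f1 f1' p | p <- index_enum _].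
  by rewrite /shape -!map_comp; apply: eq_map => p /=; rewrite sz.
have [u uX] := linear_of_free (X f1 f1') (X f2 f2').
have {}uX : map u (X f1 f1') = X f2 f2'.
  by apply: uX; [exact: basis_free (Xb _ _) | rewrite !XE !size_flatten sh].
have ub p : map u (b f1 f1' p) = b f2 f2' p.
  move: uX; rewrite !XE map_flatten => uX.
  have /eq_from_flatten_shape := uX; rewrite -map_comp.
  have -> : shape [seq (map u \o b f1 f1') p | p <- index_enum _]
            = shape [seq b f2 f2' p | p <- index_enum _].
    rewrite sh /shape -!map_comp; apply: eq_map => q /=.
    by rewrite size_map.
  move=> /(_ erefl) /eq_in_map; apply.
  by rewrite mem_index_enum.
pose g : 'End(V) := linfun u.
have gC p : (g @: C f1 f1' p = C f2 f2' p)%VS.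
  rewrite -(span_basis (vbasisP (C f1 f1' p))) limg_span.
  rewrite -(span_basis (vbasisP (C f2 f2' p))) -/(b f2 f2' p) -ub.
  by congr (span _); apply: eq_map => x; rewrite lfunE.
have g0 : lker g == 0%VS.
  have := limg_ker_dim g fullv; rewrite capfv.
  have -> : (g @: fullv = fullv)%VS.
    by rewrite -{1}(sumC f1 f1') limg_sum -(sumC f2 f2'); apply: eq_bigr.
  by move=> h; rewrite -dimv_eq0; apply/eqP; lia.
exists g, g0; congr pair; apply/val_inj/ffunP => i; rewrite /= ffunE.
  by rewrite (fE f1 f1') (fE f2 f2') limg_sum; apply: eq_bigr.
by rewrite (fE' f1 f1') (fE' f2 f2') limg_sum; apply: eq_bigr.
Qed.

End NatFlags.

Section OrbitMatrix.
Variables (n r : nat) (k : fieldType) (V : vectType k) (dV : \dim {:V} = r).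
Implicit Types f : flag n V.

Lemma rel_pos_lt f f' i j : (rel_pos f f' i j < r.+1)%N.
Proof.
by rewrite ltnS -dV -(rel_pos_sum f f') (bigD1 i) //= (bigD1 j) //=; lia.
Qed.

Lemma orbit_mx_subproof f f' :
  (\sum_i \sum_j (\matrix_(i, j) Ordinal (rel_pos_lt f f' i j)) i j)%N == r.
Proof.
apply/eqP; rewrite -[RHS]dV -(rel_pos_sum f f').
by apply: eq_bigr => i _; apply: eq_bigr => j _; rewrite mxE.
Qed.

(* A(f, f'), whose orbit is [f, f']. *)
Definition orbit_mx f f' : smx n r :=
  exist _ (\matrix_(i, j) Ordinal (rel_pos_lt f f' i j))
          (orbit_mx_subproof f f').

Lemma orbit_mxE f f' i j : val (orbit_mx f f') i j = rel_pos f f' i j :> nat.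
Proof. by rewrite mxE. Qed.

Lemma orbit_mxP f1 f1' f2 f2' :
  flag_orbit f1 f1' (f2, f2') <-> orbit_mx f2 f2' = orbit_mx f1 f1'.
Proof.
rewrite flag_orbitP; split=> [eqA | eqA]; last first.
  by apply/matrixP => i j; rewrite -!orbit_mxE eqA.
apply/val_inj/matrixP => i j; apply: val_inj.
by rewrite /= [LHS]orbit_mxE [RHS]orbit_mxE eqA.
Qed.

(* e_A, as a set of pairs of flags. *)
Definition orbit_of (A : smx n r) : set (flag n V * flag n V) :=
  [set p | orbit_mx p.1 p.2 = A].

End OrbitMatrix.

Section QSchur.
Variables (n r : nat).

(* Z[q] is {poly int}, with q = 'X. *)
Definition qschur : Type := {ffun smx n r -> {poly int}^o}.
HB.instance Definition _ := GRing.Lmodule.on qschur.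

Definition qbasis (A : smx n r) : qschur := [ffun B => (B == A)%:R].

(* Evaluation at the infinitely many cardinalities of finite fields determines
   g, so that structure_polys g says that g is the family of structure
   constants of the q-Schur algebra. *)
Definition structure_polys (g : smx n r -> smx n r -> smx n r -> {poly int}) :
    Prop :=
  forall (F : finFieldType) (V : vectType F) (dV : \dim {:V} = r)
         (A A' A'' : smx n r) (f1 f2 : flag n V),
    orbit_of dV A'' (f1, f2) ->
    exists2 N : nat,
      ([set f | orbit_of dV A (f1, f) /\ orbit_of dV A' (f, f2)] #= `I_N)%card
      & (g A A' A'').[#|F|%:R] = N%:R.

Variable g : smx n r -> smx n r -> smx n r -> {poly int}.

Definition qmul (x y : qschur) : qschur :=
  \sum_A \sum_A' (x A * y A' : {poly int}) *:
     \sum_A'' g A A' A'' *: qbasis A''.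

Lemma qmul_basis A A' :
  qmul (qbasis A) (qbasis A') = \sum_A'' g A A' A'' *: qbasis A''.
Proof.
rewrite /qmul (bigD1 A) //= [X in _ + X]big1 ?addr0 => [|B neB]; last first.
  by rewrite big1 // => B' _; rewrite !ffunE (negbTE neB) mul0r scale0r.
rewrite (bigD1 A') //= [X in _ + X]big1 ?addr0 => [|B neB]; last first.
  by rewrite !ffunE (negbTE neB) mulr0 scale0r.
by rewrite !ffunE !eqxx mulr1 scale1r.
Qed.

Variables (k : fieldType) (V : vectType k) (dV : \dim {:V} = r).

(* [f, f'] as an element of the q-Schur algebra. *)
Definition orbit_elt (f f' : flag n V) : qschur := qbasis (orbit_mx dV f f').

Definition sum_prod (f1 f2 : flag n V) : qschur :=
  qmul (orbit_elt f1 (flag_add f1 f2)) (orbit_elt (flag_add f1 f2) f2).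

Lemma sum_prod_orbit f1 f2 f1' f2' :
  flag_orbit f1 f2 (f1', f2') -> sum_prod f1' f2' = sum_prod f1 f2.
Proof.
case=> u [u0 [-> ->]].
have actD f f' : flag_add (flag_act u0 f) (flag_act u0 f')
                 = flag_act u0 (flag_add f f').
  by apply/val_inj/ffunP=> i; rewrite /= !ffunE limgD.
rewrite /sum_prod /orbit_elt actD; congr (qmul (qbasis _) (qbasis _));
  by apply/orbit_mxP; exists u, u0.
Qed.

(* By sum_prod_orbit, letting f1 and f2 range over all flags amounts to letting
   [f1, f2] range over all orbits. *)
Definition sum_prod_set : set qschur :=
  [set x | exists f1 f2 : flag n V, x = sum_prod f1 f2].

End QSchur.

(* Main.v *)
Require Import Defs.
From mathcomp Require Import all_boot all_order all_algebra.
From mathcomp Require Import boolp classical_sets functions cardinality.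
From mathcomp Require Import zify.

Set Implicit Arguments.
Unset Strict Implicit.
Unset Printing Implicit Defensive.

Import GRing.Theory.

Local Open Scope classical_set_scope.
Local Open Scope ring_scope.

(** The products [f1, f1 + f2] [f1 + f2, f2] are unitriangular with respect to
    the basis of orbits, for the order given by the weight
    [sum_weight f1 f2], the sum over s of the dimensions of (f1 + f2)_s.

    Over a finite field, let (h1, h2) be a pair of flags.  The coefficient at
    [h1, h2] of the product attached to [a1, a2] counts the flags m such that
    (h1, m) is positioned as (a1, a1 + a2) and (m, h2) as (a1 + a2, a2).  Since
    a1 and a2 lie below a1 + a2, such an m contains h1 and h2, hence h1 + h2,
    and its spaces have the dimensions of those of a1 + a2.  So the weight of
    (h1, h2) is at most that of (a1, a2), and equality forces m = h1 + h2
    ([middle_flagE]).  In the latter case (h1, h1 + h2) and (h1 + h2, h2) are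
    positioned as (a1, a1 + a2) and (a1 + a2, a2), and this implies that
    (h1, h2) is positioned as (a1, a2) ([capdim_add_inj]): for t <= s the
    modular law gives
      a1_s :&: (a1_t + a2_t) = a1_t + (a1_s :&: a2_t),
    so that the dimensions of a1_s :&: a2_t can be read off.  Conversely, if
    (h1, h2) is positioned as (a1, a2), then m = h1 + h2 is a solution, hence
    the only one, and the diagonal coefficient is 1.

    The flags a1, a2 of the statement live over a field k which has nothing to
    do with the finite fields used to evaluate the structure polynomials.  All
    comparisons are therefore made through the numbers
    [capdim f f' s t] = dim (f_s :&: f'_t), which determine the matrix of a pair
    and are determined by it over any two fields ([orbit_mx_eqP]), and every
    matrix is realized by coordinate flags over every field ([orbit_mx_surj]).
    The prime fields are enough to identify an integral polynomial
    ([poly_eq_primes]). *)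

(** * Dimensions attached to a pair of flags *)

Lemma hiE n (i : 'I_n) : hi i = i.+1 :> nat.
Proof. exact: lift0. Qed.

Lemma ord_step_ind n (P : 'I_n.+1 -> Prop) :
  P ord0 -> (forall i : 'I_n, P (lo i) -> P (hi i)) -> forall s, P s.
Proof.
move=> P0 PS [s]; elim: s => [|s IHs] lt_s.
  by rewrite (_ : Ordinal lt_s = ord0) //; apply: val_inj.
have lt_sn : (s < n)%N by [].
rewrite (_ : Ordinal lt_s = hi (Ordinal lt_sn)); last exact: val_inj.
apply: PS; have lt_s' : (s < n.+1)%N by apply: ltnW.
by rewrite (_ : lo _ = Ordinal lt_s') //; apply: val_inj.
Qed.

Section FlagDimensions.
Context {n : nat} {k : fieldType} {V : vectType k}.
Implicit Types f : flag n V.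

Lemma flag0 f : f ord0 = 0%VS.
Proof. by case/and3P: (flag_axiom f) => /eqP. Qed.

Lemma flag_max f : f ord_max = fullv.
Proof. by case/and3P: (flag_axiom f) => _ /eqP. Qed.

Lemma flag_step f i : (f (lo i) <= f (hi i))%VS.
Proof. by case/and3P: (flag_axiom f) => _ _ /forallP. Qed.

Lemma flag_mono f (s t : 'I_n.+1) : (s <= t)%N -> (f s <= f t)%VS.
Proof.
elim/ord_step_ind: t => [|i IHi]; rewrite leq_eqVlt => /predU1P[/ord_inj->|] //.
by rewrite hiE ltnS => /IHi le_f; apply: subv_trans le_f (flag_step f i).
Qed.

Lemma flag_addC f f' : flag_add f f' = flag_add f' f.
Proof. by apply/val_inj/ffunP => i; rewrite !ffunE addvC. Qed.

Definition capdim f f' (s t : 'I_n.+1) : nat := \dim (f s :&: f' t)%VS.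

Lemma capdimC f f' s t : capdim f f' s t = capdim f' f t s.
Proof. by rewrite /capdim capvC. Qed.

Lemma capdim0l f f' t : capdim f f' ord0 t = 0%N.
Proof. by rewrite /capdim flag0 cap0v dimv0. Qed.

Lemma capdim0r f f' s : capdim f f' s ord0 = 0%N.
Proof. by rewrite capdimC capdim0l. Qed.

Lemma capdim_maxr f f' s : capdim f f' s ord_max = \dim (f s).
Proof. by rewrite /capdim flag_max capvf. Qed.

Lemma capdim_subv f f' s t :
  capdim f f' s t = \dim (f s) -> (f s <= f' t)%VS.
Proof. by move=> eqd; apply/capv_idPl/eqP; rewrite eqEdim capvSl -eqd /=. Qed.

(** The matrix of a pair of flags is the second difference of [capdim], written
    here without subtraction. *)
Lemma rel_pos_capdim f f' i j :
  (rel_pos f f' i j + (capdim f f' (lo i) (hi j) + capdim f f' (hi i) (lo j))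
   = capdim f f' (hi i) (hi j) + capdim f f' (lo i) (lo j))%N.
Proof.
rewrite mxE /capdim; have sU := flag_step f i; have sW := flag_step f' j.
have := dimvS (addvS (subvv (f (lo i))) (capvS (subvv (f (hi i))) sW)).
have := dimv_sum_cap (f (lo i)) (f (hi i) :&: f' (hi j)).
have := dimv_sum_cap (f (lo i)) (f (hi i) :&: f' (lo j)).
by rewrite !capvA (capv_idPl sU); lia.
Qed.

Lemma capdim_add_le f f' (s t : 'I_n.+1) :
  (s <= t)%N -> capdim f (flag_add f f') s t = \dim (f s).
Proof.
move=> le_st; rewrite /capdim ffunE; congr (\dim _); apply/capv_idPl.
by apply: subv_trans (addvSl _ _); apply: flag_mono.
Qed.

(** The modular law turns the space measured on the left-hand side into
    f_t + (f_s :&: f'_t), as f_t is contained in f_s. *)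
Lemma capdim_add_ge f f' (s t : 'I_n.+1) :
  (t <= s)%N ->
  (capdim f (flag_add f f') s t + capdim f f' t t
   = \dim (f t) + capdim f f' s t)%N.
Proof.
move=> le_ts; have sUW := flag_mono f le_ts.
rewrite /capdim ffunE capvC -vspace_modl // [(f' t :&: _)%VS]capvC.
by have := dimv_sum_cap (f t) (f s :&: f' t); rewrite capvA (capv_idPl sUW).
Qed.

End FlagDimensions.

(** * Comparing pairs of flags over two fields *)

Section Transfer.
Context {n : nat} {k l : fieldType} {V : vectType k} {W : vectType l}.
Implicit Types (f : flag n V) (h : flag n W).

Lemma dim_flag_transfer f f' h h' :
  capdim f f' =2 capdim h h' -> forall s, \dim (f s) = \dim (h s).
Proof. by move=> eqc s; rewrite -(capdim_maxr f f') eqc capdim_maxr. Qed.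

Lemma capdim_add_transfer f f' h h' :
  capdim f f' =2 capdim h h' ->
  capdim f (flag_add f f') =2 capdim h (flag_add h h').
Proof.
move=> eqc s t; have eqd := dim_flag_transfer eqc.
have [le_st|/ltnW le_ts] := leqP s t; first by rewrite !capdim_add_le.
have := capdim_add_ge f f' le_ts; have := capdim_add_ge h h' le_ts.
by rewrite !eqc eqd; lia.
Qed.

Lemma capdim_add_transfer_r f f' h h' :
  capdim f f' =2 capdim h h' ->
  capdim (flag_add f f') f' =2 capdim (flag_add h h') h'.
Proof.
move=> eqc s t; rewrite !(capdimC (flag_add _ _)) flag_addC (flag_addC h).
by apply: capdim_add_transfer => a b; rewrite capdimC eqc capdimC.
Qed.

(** For t <= s, [capdim_add_ge] gives dim (f_s :&: f'_t) in terms of the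
    position of (f, f + f') and of dim (f_t :&: f'_t), and the latter is
    dim f_t + dim f'_t - dim (f_t + f'_t).  The case s <= t is symmetric and
    uses the position of (f + f', f'). *)
Lemma capdim_add_inj f f' h h' :
  capdim f (flag_add f f') =2 capdim h (flag_add h h') ->
  capdim (flag_add f f') f' =2 capdim (flag_add h h') h' ->
  capdim f f' =2 capdim h h'.
Proof.
move=> eql eqr.
have eqd := dim_flag_transfer eql.
have eqa := dim_flag_transfer eqr.
have eqd' s : \dim (f' s) = \dim (h' s).
  apply: (@dim_flag_transfer f' (flag_add f f') h' (flag_add h h')) => a b.
  by rewrite capdimC eqr capdimC.
have eqtt t : capdim f f' t t = capdim h h' t t.
  have := dimv_sum_cap (f t) (f' t); have := dimv_sum_cap (h t) (h' t).
  by have := eqa t; rewrite /capdim !ffunE -eqd -eqd'; lia.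
move=> s t; have [le_st|/ltnW le_ts] := leqP s t.
  have := capdim_add_ge f' f le_st; have := capdim_add_ge h' h le_st.
  rewrite -!(capdimC _ f') -!(capdimC _ h') (flag_addC f') (flag_addC h').
  by rewrite eqr eqd' eqtt; lia.
have := capdim_add_ge f f' le_ts; have := capdim_add_ge h h' le_ts.
by rewrite eql eqd eqtt; lia.
Qed.

(** [capdim] vanishes as soon as one index is 0, so it is recovered from its
    second differences by a double induction. *)
Lemma orbit_mx_eqP r (dV : \dim {:V} = r) (dW : \dim {:W} = r) f f' h h' :
  orbit_mx dV f f' = orbit_mx dW h h' <-> capdim f f' =2 capdim h h'.
Proof.
split=> [eqA | eqc]; last first.
  apply/val_inj/matrixP => i j; apply: val_inj.
  rewrite /= [LHS]orbit_mxE [RHS]orbit_mxE.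
  by have := rel_pos_capdim f f' i j; have := rel_pos_capdim h h' i j;
    rewrite !eqc; lia.
elim/ord_step_ind => [|i IHi] t; first by rewrite !capdim0l.
elim/ord_step_ind: t => [|j IHj]; first by rewrite !capdim0r.
have := rel_pos_capdim f f' i j; have := rel_pos_capdim h h' i j.
by rewrite -(orbit_mxE dV) -(orbit_mxE dW) eqA !IHi IHj; lia.
Qed.

End Transfer.

(** * Every matrix is the position of a pair of flags *)

Section Realization.
Context {k : fieldType} {V : vectType k}.

Definition coord_space (P : pred 'I_(\dim {:V})) : {vspace V} :=
  <<[seq tnth (vbasis {:V}) i | i <- enum P]>>%VS.

Lemma dim_coord_space P : \dim (coord_space P) = #|P|.
Proof.
have freeb := basis_free (vbasisP {:V}).
rewrite cardE -(size_map (tnth (vbasis {:V}))); apply/eqP.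
suff sub : subseq [seq tnth (vbasis {:V}) i | i <- enum P] (vbasis {:V}).
  by rewrite -/(free _) (subseq_uniqP (free_uniq freeb) sub) filter_free.
rewrite -[X in subseq _ X](map_tnth_enum (vbasis {:V})).
apply: map_subseq.
by rewrite enumT {1}/enum_mem filter_subseq.
Qed.

Lemma coord_spaceU P Q :
  (coord_space P + coord_space Q)%VS = coord_space (predU P Q).
Proof.
rewrite -span_cat -map_cat; apply/eq_span/eq_mem_map => i.
by rewrite mem_cat !mem_enum.
Qed.

Lemma dim_coord_spaceI P Q :
  \dim (coord_space P :&: coord_space Q) = #|predI P Q|.
Proof.
have := dimv_sum_cap (coord_space P) (coord_space Q); have := cardUI P Q.
by rewrite coord_spaceU !dim_coord_space => <- /addnI.
Qed.

Lemma coord_spaceS (P Q : pred _) :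
  {subset P <= Q} -> (coord_space P <= coord_space Q)%VS.
Proof.
move=> sPQ; apply: sub_span => _ /mapP[i Pi ->]; apply/map_f.
by move: Pi; rewrite !mem_enum; apply: sPQ.
Qed.

Context {n : nat}.

Lemma coord_flag_subproof (c : 'I_(\dim {:V}) -> 'I_n) :
  is_flag [ffun s : 'I_n.+1 => coord_space (fun m => (c m < s)%N)].
Proof.
apply/and3P; split; rewrite ?ffunE.
- by rewrite -dimv_eq0 dim_coord_space eq_card0.
- rewrite eqEdim subvf dim_coord_space eq_cardT => [|m].
    by rewrite -cardT card_ord leqnn.
  exact: ltn_ord.
- apply/forallP => i; rewrite !ffunE; apply: coord_spaceS => m.
  by have : (c m < lo i -> c m < hi i)%N by rewrite hiE => /leqW.
Qed.

(** The m-th basis vector enters this flag at step c m. *)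
Definition coord_flag c : flag n V := Flag (coord_flag_subproof c).

Lemma capdim_coord_flag c c' s t :
  capdim (coord_flag c) (coord_flag c') s t
  = (\sum_m ((c m < s) && (c' m < t)))%N.
Proof.
rewrite /capdim !ffunE dim_coord_spaceI -sum1_card big_mkcond.
by apply: eq_bigr => m _; rewrite inE /=; case: ifP.
Qed.

Lemma rel_pos_coord_flag c c' i j :
  rel_pos (coord_flag c) (coord_flag c') i j
  = (\sum_m ((c m == i) && (c' m == j)))%N.
Proof.
have := rel_pos_capdim (coord_flag c) (coord_flag c') i j.
rewrite !capdim_coord_flag -!big_split /=.
set S := (X in (_ + X)%N = _); set T := (X in _ = X -> _).
move=> relT; apply: (@addIn S); rewrite relT.
rewrite -big_split; apply: eq_bigr => m _ /=.
rewrite -!(inj_eq (@ord_inj _)) /= !ltnS.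
by case: (ltngtP (c m) i) => _; case: (ltngtP (c' m) j) => _.
Qed.

(** Label the basis vectors by the positions (i, j), each used A i j times: this
    is possible because the entries of A sum to the dimension. *)
Lemma orbit_mx_surj r (dV : \dim {:V} = r) (A : smx n r) :
  exists f f' : flag n V, orbit_mx dV f f' = A.
Proof.
pose a (p : 'I_n * 'I_n) : nat := val A p.1 p.2.
pose s := flatten [seq nseq (a p) p | p <- index_enum _].
have sumS (F : 'I_n * 'I_n -> nat) : (\sum_(x <- s) F x = \sum_p a p * F p)%N.
  rewrite big_flatten big_map; apply: eq_bigr => p _.
  by rewrite big_nseq iter_addn_0 mulnC.
have sz : size s == \dim {:V}.
  rewrite dV -sum1_size sumS -(eqP (valP A)) pair_bigA /=; apply/eqP.
  by apply: eq_bigr => p _; rewrite muln1.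
pose lbl m := tnth (Tuple sz) m.
exists (coord_flag (fun m => (lbl m).1)), (coord_flag (fun m => (lbl m).2)).
apply/val_inj/matrixP => i j; apply: val_inj; rewrite /= [LHS]orbit_mxE.
rewrite rel_pos_coord_flag.
rewrite -(big_tuple _ _ (Tuple sz) xpredT
  (fun p : 'I_n * 'I_n => ((p.1 == i) && (p.2 == j) : nat))) /=.
rewrite sumS (bigD1 (i, j)) //= !eqxx muln1 big1 ?addn0 // => -[i' j'] /=.
rewrite -[(i', j') == _]/((i' == i) && (j' == j)) => /negbTE->.
by rewrite muln0.
Qed.

End Realization.

(** * Unitriangular families and integral polynomials *)

(** Independence: in a vanishing combination, the coefficient of a b A with w A
    maximal is the value of the combination at A.  Spanning: by induction on
    w A, the unit vector at A is b A minus a combination of unit vectors of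
    smaller weight. *)
Lemma unitriangular_is_basis (T : finType) (R : nzRingType)
    (b : T -> {ffun T -> R^o}) (w : T -> nat) :
  (forall A, b A A = 1) ->
  (forall A B, b A B != 0 -> B = A \/ (w B < w A)%N) ->
  is_basis [set x | exists A, x = b A].
Proof.
move=> b1 btri.
have binj : injective b.
  move=> A B eqb; have nz := oner_neq0 R.
  have [//|ltBA] : B = A \/ (w B < w A)%N by apply: btri; rewrite eqb b1.
  have [//|] : A = B \/ (w A < w B)%N by apply: btri; rewrite -eqb b1.
  by rewrite ltnNge ltnW.
split=> [s c uniq_s sb sum0 v vs|x].
  apply/eqP/negPn/negP => cv0.
  have [A0 defv] := sb v vs.
  pose P A := (b A \in s) && (c (b A) != 0).
  have PA0 : P A0 by rewrite /P -defv vs.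
  case: (@arg_maxnP _ A0 P w PA0) => A /andP[As cA] maxA.
  case/negP: cA; apply/eqP.
  have := congr1 (fun x : {ffun T -> R^o} => x A) sum0.
  rewrite sum_ffunE ffunE (bigD1_seq (b A)) //= ffunE b1 [_ *: _]mulr1.
  rewrite big_seq_cond big1 ?addr0 // => u /andP[us neu].
  have [B defu] := sb u us; rewrite ffunE defu.
  have [->|cB] := eqVneq (c (b B)) 0; first by rewrite scale0r.
  have [->|nz] := eqVneq (b B A) 0; first by rewrite scaler0.
  have [eqAB|] := btri _ _ nz; first by rewrite defu eqAB eqxx in neu.
  by rewrite ltnNge [(w B <= _)%N]maxA // /P -defu us defu.
have base A : exists d : T -> R, [ffun B => (B == A)%:R] = \sum_B d B *: b B.
  have [m] := ubnP (w A); elim: m A => // m IHm A lt_wA.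
  have /choice[d dE] (B : T) : exists d : T -> R, (w B < w A)%N ->
      [ffun C => (C == B)%:R] = \sum_C d C *: b C.
    case: (ltnP (w B) (w A)) => [ltBA|]; last by exists (fun=> 0).
    by have [|d dE] := IHm B; [apply: leq_trans ltBA _ | exists d].
  (* Coefficients of b A - \sum_(w B < w A) b A B * (unit vector at B), each unit
     vector being replaced by its expression in the family b. *)
  exists (fun C => (C == A)%:R - \sum_(B | (w B < w A)%N) b A B * d B C).
  under eq_bigr => C _ do rewrite scalerBl scaler_suml.
  rewrite sumrB exchange_big /= (bigD1 A) //= eqxx scale1r.
  rewrite [X in _ + X - _]big1 ?addr0 => [|C /negbTE->]; last first.
    by rewrite scale0r.
  under eq_bigr => B ltBA.
    under eq_bigr => C _ do rewrite -scalerA.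
    rewrite -scaler_sumr -dE //; over.
  apply/ffunP => C; rewrite !ffunE sum_ffunE.
  under eq_bigr => B _ do rewrite !ffunE.
  have [->|neCA] := eqVneq C A.
    rewrite b1 big1 ?subr0 // => B; have [->|] := eqVneq A B.
      by rewrite ltnn.
    by rewrite scaler0.
  have [lt_CA|ge_CA] := ltnP (w C) (w A).
    rewrite (bigD1 C) //= eqxx [_ *: _]mulr1 big1 ?addr0 ?subrr // => B.
    by case/andP=> _; rewrite eq_sym => /negbTE->; rewrite scaler0.
  have [->|nz] := eqVneq (b A C) 0; last first.
    have [eqCA|] := btri _ _ nz; first by rewrite eqCA eqxx in neCA.
    by rewrite ltnNge ge_CA.
  rewrite big1 ?subr0 // => B ltBA; have [eqCB|] := eqVneq C B.
    by rewrite -eqCB ltnNge ge_CA in ltBA.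
  by rewrite scaler0.
have [d dE] := choice base.
pose e B := \sum_A x A * d A B.
exists [seq b A | A <- enum T].
exists (fun v => if [pick A | b A == v] is Some A then e A else 0).
split=> [_ /mapP[A _ ->]|]; first by exists A.
rewrite big_map big_enum /=.
under eq_bigr => A _.
  have -> : [pick A' | b A' == b A] = Some A.
    by case: pickP => [A' /eqP/binj->//|/(_ A)]; rewrite eqxx.
  rewrite scaler_suml; under eq_bigr => B _ do rewrite -scalerA; over.
rewrite exchange_big /=; under eq_bigr => B _ do rewrite -scaler_sumr -dE.
apply/ffunP => A; rewrite sum_ffunE (bigD1 A) //= big1 ?addr0.
  by rewrite !ffunE eqxx [_ *: _]mulr1.
by move=> B neBA; rewrite !ffunE eq_sym (negbTE neBA) scaler0.
Qed.

(** A nonzero difference would have infinitely many roots. *)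
Lemma poly_eq_primes (P Q : {poly int}) :
  (forall p, prime p -> P.[p%:R] = Q.[p%:R]) -> P = Q.
Proof.
move=> eqPQ; apply/eqP; rewrite -subr_eq0; apply/negPn/negP => nz.
have [s [uniq_s pr_s sz_s]] : exists s : seq nat,
    [/\ uniq s, all prime s & size s = size (P - Q)].
  elim: (size _) => [|m [s [uniq_s pr_s sz_s]]]; first by exists [::].
  have [p lt_p pr_p] := prime_above (\max_(x <- s) x).
  exists (p :: s); split; rewrite /= ?pr_p ?sz_s // uniq_s andbT.
  by apply/negP => ps; rewrite ltnNge leq_bigmax_seq in lt_p.
have rootsPQ : all (root (P - Q)) [seq p%:R | p <- s].
  apply/allP => _ /mapP[p /(allP pr_s) pr_p ->].
  by rewrite rootE hornerD hornerN eqPQ // subrr.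
have := max_poly_roots nz rootsPQ; rewrite size_map sz_s ltnn.
rewrite map_inj_uniq ?uniq_s => [/(_ isT)|x y] //.
by rewrite !natz => -[].
Qed.

(** * The flags counted by the structure constants *)

Definition sum_weight n (k : fieldType) (V : vectType k) (f f' : flag n V) :=
  (\sum_s \dim (flag_add f f' s))%N.

Section MiddleFlags.
Context {n : nat} {k l : fieldType} {V : vectType k} {W : vectType l}.

Lemma capdim_sum_weight (a a' : flag n V) (h h' : flag n W) :
  capdim h h' =2 capdim a a' -> sum_weight h h' = sum_weight a a'.
Proof.
move/capdim_add_transfer_r/dim_flag_transfer=> eqd.
by apply: eq_bigr => s _; apply: eqd.
Qed.

(** The flags that the structure constant at (h, h') of the product attached to
    (a, a') counts; the two pairs may live over different fields. *)
Definition middle_flags (a a' : flag n V) (h h' : flag n W) : set (flag n W) :=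
  [set m | capdim h m =2 capdim a (flag_add a a')
           /\ capdim m h' =2 capdim (flag_add a a') a'].

Variables (a a' : flag n V) (h h' m : flag n W).
Hypothesis mP : middle_flags a a' h h' m.

Let hm : capdim h m =2 capdim a (flag_add a a'). Proof. by case: mP. Qed.
Let mh' : capdim m h' =2 capdim (flag_add a a') a'. Proof. by case: mP. Qed.

Let dim_m s : \dim (m s) = \dim (flag_add a a' s).
Proof. exact: dim_flag_transfer mh' s. Qed.

(** An inclusion of flags is visible on [capdim], so a <= a + a' forces h <= m,
    and likewise h' <= m. *)
Lemma flag_add_sub_middle s : (flag_add h h' s <= m s)%VS.
Proof.
have m'h : capdim h' m =2 capdim a' (flag_add a' a).
  by move=> x y; rewrite capdimC mh' capdimC flag_addC.
rewrite ffunE subv_add; apply/andP; split; apply: capdim_subv.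
  by rewrite hm capdim_add_le // (dim_flag_transfer hm).
by rewrite m'h capdim_add_le // (dim_flag_transfer m'h).
Qed.

Lemma sum_weight_middle : (sum_weight h h' <= sum_weight a a')%N.
Proof.
apply: leq_sum => s _; rewrite -dim_m.
exact/dimvS/flag_add_sub_middle.
Qed.

Lemma middle_flagE : sum_weight h h' = sum_weight a a' -> m = flag_add h h'.
Proof.
move=> eqw; apply/val_inj/ffunP => s; apply/esym/eqP.
rewrite eqEdim flag_add_sub_middle /= dim_m.
have := @leqif_sum _ xpredT _ (fun s => \dim (flag_add h h' s))
  (fun s => \dim (flag_add a a' s)).
move=> /(_ _ (fun s _ => leqif_eq _))[s'|_].
  by rewrite -dim_m dimvS // flag_add_sub_middle.
rewrite -[X in X == _]/(sum_weight h h') eqw eqxx.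
by move/esym/forallP/(_ s)/eqP => ->.
Qed.

Lemma sum_weight_middle_eq :
  sum_weight h h' = sum_weight a a' -> capdim h h' =2 capdim a a'.
Proof.
by move/middle_flagE=> defm; apply: capdim_add_inj; rewrite -defm.
Qed.

End MiddleFlags.

(** * Coefficients of the products *)

Section Coefficients.
Context {n r : nat} {k : fieldType} {V : vectType k}.
Variables (dV : \dim {:V} = r).
Variable (g : smx n r -> smx n r -> smx n r -> {poly int}).
Hypothesis hg : structure_polys g.
Implicit Types a b : flag n V.

Lemma sum_prodE a a' B :
  sum_prod g dV a a' B
  = g (orbit_mx dV a (flag_add a a')) (orbit_mx dV (flag_add a a') a') B.
Proof.
rewrite /sum_prod qmul_basis sum_ffunE (bigD1 B) //= big1 ?addr0.
  by rewrite !ffunE eqxx [_ *: _]mulr1.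
by move=> C neC; rewrite !ffunE eq_sym (negbTE neC) scaler0.
Qed.

(** The defining property of the structure polynomials over the prime field of
    order p, where both b, b' and the counting problem are transported from k. *)
Lemma sum_prod_eval a a' b b' p : prime p ->
  exists h h' : flag n 'rV['F_p]_r, exists2 N : nat,
    capdim h h' =2 capdim b b' /\
    (middle_flags a a' h h' #= `I_N)%card
    & (sum_prod g dV a a' (orbit_mx dV b b')).[p%:R] = N%:R.
Proof.
move=> pr_p; have dW : \dim {:'rV['F_p]_r} = r by rewrite dimvf /dim /= mul1n.
have [h [h' eqB]] := orbit_mx_surj dW (orbit_mx dV b b').
exists h, h'; rewrite sum_prodE.
have [N cardN gN] := hg (orbit_mx dV a (flag_add a a'))
  (orbit_mx dV (flag_add a a') a') (A'' := orbit_mx dV b b')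
  (f1 := h) (f2 := h') eqB.
exists N; last by rewrite -gN card_Fp.
split; first exact: (proj1 (orbit_mx_eqP dW dV h h' b b') eqB).
move: cardN; congr (is_true (_ #= _)%card); apply/seteqP.
split=> m [hm mh']; split.
- exact: (proj1 (orbit_mx_eqP _ _ _ _ _ _) hm).
- exact: (proj1 (orbit_mx_eqP _ _ _ _ _ _) mh').
- exact: (proj2 (orbit_mx_eqP _ _ _ _ _ _) hm).
- exact: (proj2 (orbit_mx_eqP _ _ _ _ _ _) mh').
Qed.

Lemma sum_prod_diag a a' : sum_prod g dV a a' (orbit_mx dV a a') = 1.
Proof.
apply: poly_eq_primes => p pr_p; rewrite hornerE.
have [h [h' [N [eqc cardN] ->]]] := sum_prod_eval a a' a a' pr_p.
move: cardN; suff -> : middle_flags a a' h h' = [set flag_add h h'].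
  by rewrite (card_eql card_set1) => /card_eq_II <-.
apply/seteqP; split=> [m mP | _ ->] /=.
  exact/(middle_flagE mP)/capdim_sum_weight.
by split; [apply: capdim_add_transfer | apply: capdim_add_transfer_r].
Qed.

Lemma sum_prod_triangular a a' b b' :
  sum_prod g dV a a' (orbit_mx dV b b') != 0 ->
  orbit_mx dV b b' = orbit_mx dV a a' \/ (sum_weight b b' < sum_weight a a')%N.
Proof.
move=> nz; have [|le_ab] := ltnP; [by right | left].
apply: contrapT => neq; case/eqP: nz.
apply: poly_eq_primes => p pr_p; rewrite hornerE.
have [h [h' [N [eqc cardN] ->]]] := sum_prod_eval a a' b b' pr_p.
move: cardN; suff -> : middle_flags a a' h h' = set0.
  rewrite card_eq_sym card_eq0 => /eqP.
  by case: N => // N /seteqP[] /(_ 0%N isT).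
rewrite -subset0 => m mP; apply: neq; apply/orbit_mx_eqP => s t.
rewrite -eqc; apply: (sum_weight_middle_eq mP).
by apply/eqP; rewrite eqn_leq (sum_weight_middle mP) (capdim_sum_weight eqc).
Qed.

End Coefficients.

(** * The basis theorem *)

Theorem theorem4p2 (n r : nat) (n_gt0 : (0 < n)%N) (r_gt0 : (0 < r)%N)
    (k : fieldType)
    (hk : finite_set [set: k] \/ GRing.closed_field_axiom k)
    (V : vectType k) (dV : \dim {:V} = r)
    (g : smx n r -> smx n r -> smx n r -> {poly int})
    (hg : structure_polys g) :
  is_basis (sum_prod_set g dV).
Proof.
have /choice[fl flE] (A : smx n r) :
    exists p : flag n V * flag n V, orbit_mx dV p.1 p.2 = A.
  by have [f [f' <-]] := orbit_mx_surj dV A; exists (f, f').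
have -> : sum_prod_set g dV
          = [set x | exists A, x = sum_prod g dV (fl A).1 (fl A).2].
  apply/seteqP; split=> x; last by case=> A ->; exists (fl A).1, (fl A).2.
  case=> f1 [f2 ->]; exists (orbit_mx dV f1 f2).
  by apply: sum_prod_orbit; apply/(orbit_mxP dV); rewrite flE.
apply: (unitriangular_is_basis
  (w := fun A => sum_weight (fl A).1 (fl A).2)) => [A | A B].
  by have := sum_prod_diag dV hg (fl A).1 (fl A).2; rewrite flE.
have := @sum_prod_triangular _ _ _ _ dV _ hg
  (fl A).1 (fl A).2 (fl B).1 (fl B).2.
by rewrite !flE.
Qed.
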